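(* Let $q\ge1$. The facets of $\mathbb{S}^3_q$ are the sets of the following types: (1) (when $q\ge1$) $\mathcal{U}^3_{2\mathbf e_a}=\{2\mathbf e_a+\mathbf e_i : i\in[q]\}$ for some $a\in[q]$; (2) (when $q\ge2$) $\mathcal{U}^3_{\mathbf e_a+\mathbf e_b}=\{\mathbf e_a+\mathbf e_b+\mathbf e_i : i\in[q]\}$ for some $a,b\in[q]$ with $a\ne b$; (3) (when $q\ge3$) $\mathcal{U}^3_{\mathbf e_a}=\{\mathbf e_a+\mathbf e_i+\mathbf e_j : i,j\in[q],\ i<j\}$ for some $a\in[q]$; (4) (when $q\ge4$) $\mathcal{U}^3_q=\{\mathbf e_i+\mathbf e_j+\mathbf e_k : 1\le i<j<k\le q\}$; (5) (when $q\ge5$) the simplex $W_{P,a}$ for some $P\subseteq[q]$ with $2\le|P|\le q-3$ and $a\in P$. In particular, $$\mathbb{S}^3_q=\mathbb{U}^3_q\cup\langle W_{P,a} : P\subseteq[q],\ 2\le|P|\le q-3,\ a\in P\rangle .$$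
   Context: Let $\mathsf{k}$ be a field, $[q]=\{1,\dots,q\}$, $\mathbf e_i$ the $i$-th standard unit vector of $\mathbb{R}^q$, $|\mathbf a|=a_1+\cdots+a_q$, and $\mathcal{N}^r_q=\{\mathbf a\in\mathbb{N}^q : |\mathbf a|=r\}$. The $q$-extremal ideal $\mathcal{E}_q$ is the ideal of $\mathsf{k}[x_A : \emptyset\ne A\subseteq[q]]$ generated by $\epsilon_i=\prod_{A\ni i}x_A$, $i\in[q]$. Its power $\mathcal{E}_q^{\,r}$ is minimally generated by the monomials $\epsilon^{\mathbf a}=\epsilon_1^{a_1}\cdots\epsilon_q^{a_q}$, $\mathbf a\in\mathcal{N}^r_q$. Each set $\sigma\subseteq\mathcal{N}^r_q$ is labeled by $\mathbf{m}_\sigma=\mathrm{lcm}(\epsilon^{\mathbf a}:\mathbf a\in\sigma)$. The Scarf complex $\mathbb{S}^r_q$ of $\mathcal{E}_q^{\,r}$ is the simplicial complex on $\mathcal{N}^r_q$ consisting of all $\sigma\subseteq\mathcal{N}^r_q$ with $\mathbf{m}_\sigma\ne\mathbf{m}_\tau$ for every $\tau\subseteq\mathcal{N}^r_q$, $\tau\neq\sigma$. For $\mathbf a\in\mathbb{N}^q$, $\mathcal{U}^r_{\mathbf a}=\{\mathbf c\in\mathcal{N}^r_q : a_i\le c_i\le a_i+1\text{ for all }i\in[q]\}$, and $\mathcal{U}^r_q=\mathcal{U}^r_{\mathbf 0}$ is the set of $0/1$ vectors in $\mathcal{N}^r_q$. $\mathbb{U}^r_q$ is the simplicial complex generated by the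 sets $\mathcal{U}^r_{\mathbf a}$ with $\mathbf a\in\mathbb{N}^q$, $r-q<|\mathbf a|<r$. $\langle\,\cdot\,\rangle$ denotes the simplicial complex generated by the listed faces. For $a\in P\subseteq[q]$, $$W_{P,a}=\{2\mathbf e_a+\mathbf e_j : j\in P\setminus\{a\}\}\cup\{\mathbf e_j+\mathbf e_k+\mathbf e_l : j<k<l\le q,\ j,k,l\in[q]\setminus P\}\cup\{\mathbf e_a+\mathbf e_j+\mathbf e_k : 1\le j<k\le q,\ a\notin\{j,k\}\}.$$
   Formalization: The final equality of S^3_q with the union of U^3_q and the complex generated by the W_{P,a} is stated only for q ≥ 2: for q = 1 no a has 2 < |a| < 3, so the right side has no vertex, while {3e_1} is a face of S^3_1. The facet list is stated for all q ≥ 1. *)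

(* Defs.v *)
From mathcomp Require Export all_boot all_order all_algebra.
From mathcomp Require Export finmap.
From mathcomp Require Export mpoly.

Set Implicit Arguments.
Unset Strict Implicit.
Unset Printing Implicit Defensive.

Import GRing.Theory.

Local Open Scope ring_scope.
Local Open Scope fset_scope.

(* Throughout, [q] is 'I_q (so indices start at 0), N^q is 'X_{1..q}, the unit
   vector e_i is U_(i)%MM and |a| is mdeg a. *)

(* The variables x_A are indexed by the nonempty subsets A of [q]; the library
   numbers the variables of a polynomial ring, whence the use of enum_rank. *)
Notation nonempty_set q := {A : {set 'I_q} | A != set0}.

Definition nvars (q : nat) : nat := #|{: nonempty_set q}|.

Definition xvar (k : fieldType) (q : nat) (A : nonempty_set q) :
  {mpoly k[nvars q]} := 'X_(enum_rank A).

Definition eps (k : fieldType) (q : nat) (i : 'I_q) : {mpoly k[nvars q]} :=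
  \prod_(A : nonempty_set q | i \in val A) xvar k A.

Definition epsX (k : fieldType) (q : nat) (a : 'X_{1..q}) :
  {mpoly k[nvars q]} := \prod_(i < q) eps k i ^+ a i.

Lemma epsX_monomial (k : fieldType) (q : nat) (a : 'X_{1..q}) :
  epsX k a = 'X_[mlead (epsX k a)].
Proof.
have monoP (I : finType) (P : pred I) (F : I -> {mpoly k[nvars q]}) :
    (forall i, exists m, F i = 'X_[m]) -> exists m, \prod_(i | P i) F i = 'X_[m].
  move=> monoF; apply: (big_ind (fun p => exists m, p = 'X_[m])) => //.
  - by exists 0%MM; rewrite mpolyX0.
  - by move=> _ _ [m ->] [n ->]; exists (m + n)%MM; rewrite mpolyXD.
suff [m ->] : exists m, epsX k a = 'X_[m] by rewrite mleadXm.
apply/monoP => i.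
have [m ->] : exists m, eps k i = 'X_[m].
  by apply/monoP => A; exists U_(enum_rank A)%MM.
by exists (m *+ a i)%MM; rewrite mpolyXn.
Qed.

(* Since each epsilon^a is a monomial, mlead reads off its exponent vector and
   mlcm is the lcm of monomials, so this is lcm(epsilon^a : a in s). *)
Definition label (k : fieldType) (q : nat) (s : {fset 'X_{1..q}}) :
  {mpoly k[nvars q]} :=
  'X_[\big[@mlcm (nvars q)/0%MM]_(a <- s) mlead (epsX k a)].

Definition Nset (q r : nat) : {fset 'X_{1..q}} :=
  [fset bmnm c | c : 'X_{1..q < r.+1} & mdeg c == r].

Lemma in_Nset (q r : nat) (c : 'X_{1..q}) : (c \in Nset q r) = (mdeg c == r).
Proof.
apply/imfsetP/eqP => [[d /eqP dr ->] //|cr].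
have lt_c : (mdeg c < r.+1)%N by rewrite cr.
by exists (BMultinom lt_c) => //; apply/eqP.
Qed.

(* Simplicial complexes are given by their set of faces. *)
Definition complex (q : nat) : Type := {fset 'X_{1..q}} -> Prop.

Definition is_facet (q : nat) (D : complex q) (s : {fset 'X_{1..q}}) : Prop :=
  D s /\ forall t, D t -> s `<=` t -> t = s.

Definition generated (q : nat) (G : {fset 'X_{1..q}} -> Prop) : complex q :=
  fun s => exists2 F, G F & s `<=` F.

Definition Scarf (k : fieldType) (q r : nat) : complex q :=
  fun s => s `<=` Nset q r /\
    forall t, t `<=` Nset q r -> t <> s -> label k s <> label k t.
Arguments Scarf : clear implicits.

Definition Uset (q r : nat) (a : 'X_{1..q}) : {fset 'X_{1..q}} :=
  [fset c in Nset q r | [forall i, (a i <= c i <= (a i).+1)%N]].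

(* The bound r - q < |a| is in the integers, hence r < |a| + q. For q = 1 no a
   satisfies both bounds, and the complex has no faces at all. *)
Definition Ucomplex (q r : nat) : complex q :=
  generated (fun F => exists a : 'X_{1..q},
    (r < mdeg a + q)%N /\ (mdeg a < r)%N /\ F = Uset r a).
Arguments Ucomplex : clear implicits.

Definition Wset (q : nat) (P : {set 'I_q}) (a : 'I_q) : {fset 'X_{1..q}} :=
  [fset (U_(a) *+ 2 + U_(j))%MM | j : 'I_q & (j \in P) && (j != a)]
  `|` [fset (U_(t.1.1) + U_(t.1.2) + U_(t.2))%MM | t : 'I_q * 'I_q * 'I_q &
        [&& (t.1.1 < t.1.2 < t.2)%N,
            t.1.1 \notin P, t.1.2 \notin P & t.2 \notin P]]
  `|` [fset (U_(a) + U_(t.1) + U_(t.2))%MM | t : 'I_q * 'I_q &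
        [&& (t.1 < t.2)%N, a != t.1 & a != t.2]].

(* Main.v *)
From mathcomp Require Import zify.
Require Import Defs.

Set Implicit Arguments.
Unset Strict Implicit.
Unset Printing Implicit Defensive.

Local Open Scope fset_scope.

(** Write c(A) for the sum of the coordinates of c over a subset A of [q].  The
    exponent of x_A in epsilon^c is c(A), so the label of s has exponent
    max (c(A) : c in s) at x_A.  Hence s fails to be a face of the Scarf
    complex exactly when some c in N^r_q can be put into or taken out of s
    without changing any of these maxima.  This gives a criterion that treats
    members and non-members of s alike (ScarfP): s is a face iff every c of
    degree r has a separating set, i.e. a set A with d(A) < c(A) for all d in
    s other than c.  The criterion is inherited by subsets, so only maximal
    sets matter.

    The U_b satisfy it for every r and b (separated_Uset).  If c is not >= b,
    say c_i < b_i, the complement of i separates c; otherwise the set of the i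
    with c_i > b_i does, since every d in U_b is at most c there.  The W_{P,a}
    satisfy it because, apart from two easy situations, the support of c
    separates c (separated_Wset).

    Conversely, let s be separated, with r = 3.  Its elements are cubes 3e_a,
    squares 2e_a + e_b with a <> b, and squarefree triples.  If c is such that no A can
    separate c from two or three given elements of s, those elements must
    include c; this rules out most configurations:
    - if s contains 3e_a then s is contained in U_{2e_a};
    - two squares 2e_a + e_b and 2e_c + e_d with a <> c must be 2e_a + e_c and
      2e_c + e_a, and then s is contained in U_{e_a+e_c};
    - if all squares have the same centre a, let P consist of a and of the b
      with 2e_a + e_b in s; the triples of s that avoid a avoid P, which says
      that s is contained in W_{P,a}.  When fewer than three indices lie
      outside P no triple avoids a, and W_{P,a} is contained in U_{e_a};
    - if s has only squarefree elements it is contained in U_0.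
    So every face lies in one of the listed sets (separated_in_facet).  These
    are pairwise incomparable (listed_antichain): cubes and squares in a listed
    set nearly determine its type, and triples distinguish the rest.  Both
    the list of facets and the description of the complex follow. *)

(** * Labels and separating sets *)

Definition wt (q : nat) (c : 'X_{1..q}) (A : {set 'I_q}) : nat :=
  \sum_(i in A) c i.

Lemma wtT (q : nat) (c : 'X_{1..q}) : wt c setT = mdeg c.
Proof. by rewrite mdegE; apply: eq_bigl => i; rewrite inE. Qed.

Lemma wt0 (q : nat) (c : 'X_{1..q}) : wt c set0 = 0%N.
Proof. by rewrite /wt big_set0. Qed.

(** Lets a bound on one part of the coordinates be traded for a bound on the
    others, all elements under consideration having the same degree. *)
Lemma wtC (q : nat) (c : 'X_{1..q}) (A : {set 'I_q}) :
  (wt c A + wt c (~: A))%N = mdeg c.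
Proof.
rewrite mdegE (bigID (mem A)) /=; congr addn.
by apply: eq_bigl => i; rewrite inE.
Qed.

Lemma mlead_epsX (k : fieldType) (q : nat) (c : 'X_{1..q}) (A : nonempty_set q) :
  mlead (epsX k c) (enum_rank A) = wt c (val A).
Proof.
have epsE i : eps k i =
    'X_[\big[mnm_add/0%MM]_(B : nonempty_set q | i \in val B) U_(enum_rank B)%MM].
  by rewrite -mprodXE.
rewrite /epsX; under eq_bigr do rewrite epsE mpolyXn.
rewrite mprodXE mleadXm mnm_sumE /wt [RHS]big_mkcond; apply: eq_bigr => i _ /=.
rewrite mulmnE mnm_sumE; under eq_bigr do rewrite mnm1E (inj_eq enum_rank_inj).
case: ifP => iA.
  by rewrite (bigD1 A) //= eqxx big1 ?addn0 ?mul1n // => B /andP[_ /negPf->].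
by rewrite big1 ?mul0n // => B iB; case: eqP => // BA; rewrite BA iA in iB.
Qed.

(** A maximum exceeds m iff one of its terms does; phrasing labels in this way
    avoids all manipulation of maxima. *)
Lemma ltn_mlcm (n : nat) (I : Type) (s : seq I) (F : I -> 'X_{1..n}) (v : 'I_n) (m : nat) :
  (m < (\big[@mlcm n/0%MM]_(a <- s) F a) v)%N = has (fun a => m < F a v)%N s.
Proof.
elim: s => [|a s IH]; first by rewrite big_nil mnmE.
by rewrite big_cons mnmE leq_max IH.
Qed.

(** The empty set A indexes no variable, but all weights vanish there, so it can be
    allowed. *)
Lemma label_eqP (k : fieldType) (q : nat) (s t : {fset 'X_{1..q}}) :
  label k s = label k t <->
  forall (A : {set 'I_q}) n,
    has (fun d => n < wt d A)%N s = has (fun d => n < wt d A)%N t.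
Proof.
have hasE u (A : nonempty_set q) n :
    (n < (\big[@mlcm (nvars q)/0%MM]_(d <- u) mlead (epsX k d)) (enum_rank A))%N
    = has (fun d => n < wt d (val A))%N u.
  by rewrite ltn_mlcm; apply: eq_has => d; rewrite mlead_epsX.
split=> [/(congr1 (@mlead _ _)) | eq_st].
  rewrite !mleadXm => eq_st A n.
  have [->|A0] := eqVneq A set0.
    by rewrite !(eq_has (a2 := pred0)) ?has_pred0 // => d /=; rewrite wt0.
  pose B : nonempty_set q := Sub A A0.
  by have := hasE s B n; rewrite eq_st hasE.
congr ('X_[ _ ])%R; apply/mnmP => v; rewrite -(enum_valK v).
apply/eqP; rewrite eqn_leq; apply/andP; split; rewrite leqNgt hasE.
  by rewrite eq_st -hasE ltnn.
by rewrite -eq_st -hasE ltnn.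
Qed.

(** For c outside s this prevents larger sets from having the label of s, and for
    c in s it prevents smaller sets from having it. *)
Definition separated (q r : nat) (s : {fset 'X_{1..q}}) : Prop :=
  forall c : 'X_{1..q}, mdeg c = r ->
    exists A : {set 'I_q}, forall d : 'X_{1..q}, d \in s -> d <> c -> (wt d A < wt c A)%N.

(** If some c had no separating set, every weight of c would be reached by another
    element of s, and s with c removed and s with c added would share their
    label.  Conversely, if s and t have the same label, an element of one whose
    weight at its separating set is matched in the other must belong to s, then
    to t.  Degree 0 is excluded because the label of 1 is also that of the
    empty set. *)
Lemma ScarfP (k : fieldType) (q r : nat) (s : {fset 'X_{1..q}}) : (0 < r)%N ->
  Scarf k q r s <-> (s `<=` Nset q r) /\ separated r s.
Proof.
move=> r_gt0; split=> [[sN uniq_s]|[sN sep_s]]; split=> //.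
  move=> c cr; pose seps A := [forall d : s, (val d != c) ==> (wt (val d) A < wt c A)%N].
  case: (pickP seps) => [A /forallP sepA|nosep].
    by exists A => d ds /eqP dc; have := sepA [` ds]; rewrite /= dc.
  have bound A : exists2 d, d \in s & d != c /\ (wt c A <= wt d A)%N.
    have /negbT := nosep A; rewrite negb_forall => /existsP[d].
    by rewrite negb_imply -leqNgt => /andP[dc cd]; exists (val d) => //; apply: valP.
  have eq_label : label k (s `\ c) = label k (c |` s).
    apply/label_eqP => A n; apply/hasP/hasP => -[d dS nd].
      by exists d => //; move: dS; rewrite !inE => /andP[_ ->]; rewrite orbT.
    have [e es [ec ce]] := bound A.
    have [d_c|dc] := eqVneq d c.
      by exists e; [rewrite !inE ec es | apply: leq_trans nd _; rewrite d_c].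
    by exists d => //; move: dS; rewrite !inE (negPf dc).
  have cN : c |` s `<=` Nset q r by rewrite fsubUset fsub1set in_Nset cr eqxx.
  have [cs|cNs] := boolP (c \in s).
    have : s `\ c <> s by move=> E; have := fsetD11 c s; rewrite E cs.
    move=> /(uniq_s _ (fsubset_trans (fsubsetDl _ _) sN)); case.
    by rewrite eq_label fsetUC; congr label; apply/fsetP => x; rewrite !inE; case: eqP => [->|]; rewrite ?orbT ?orbF.
  have : c |` s <> s by move=> E; have := fset1U1 c s; rewrite E (negPf cNs).
  move=> /(uniq_s _ cN); case; rewrite -eq_label; congr label.
  by apply/fsetP => x; rewrite !inE; case: eqP => [->|//]; rewrite (negPf cNs).
(* A set with c(A) = 0 separates only if nothing has to be separated, and then the
   full set does as well, with c(A) = r. *)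
have sep_pos c : mdeg c = r ->
    exists2 A, (0 < wt c A)%N & forall d, d \in s -> d <> c -> (wt d A < wt c A)%N.
  move=> cr; have [A sepA] := sep_s c cr.
  have [c0|] := posnP (wt c A); last by exists A.
  by exists setT => [|d ds dc]; [rewrite wtT cr|have := sepA d ds dc; rewrite c0].
move=> t tN ts /label_eqP eq_st.
(* Applied to t and s, then to s and t once t is known to be a subset of s. *)
have inherit (u v : {fset 'X_{1..q}}) c :
    (forall A n, has (fun d => n < wt d A)%N u = has (fun d => n < wt d A)%N v) ->
    v `<=` s -> c \in Nset q r -> c \in u -> c \in v.
  rewrite in_Nset => eq_uv /fsubsetP vs /eqP cr cu.
  have [A c_gt0 sepA] := sep_pos c cr.
  have : has (fun d => (wt c A).-1 < wt d A)%N u.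
    by apply/hasP; exists c => //; rewrite prednK.
  rewrite eq_uv => /hasP[d dv]; rewrite prednK // => cd.
  have [<-//|/eqP dc] := eqVneq d c.
  by have := sepA d (vs _ dv) dc; rewrite ltnNge cd.
have sub_ts : t `<=` s.
  by apply/fsubsetP => c ct; apply: (inherit t s) => //; apply: (fsubsetP tN).
apply: ts; apply/eqP; rewrite eqEfsubset sub_ts; apply/fsubsetP => c cs.
by apply: (inherit s t) => //; apply: (fsubsetP sN).
Qed.

(** * Weights, coordinates and monomials of small degree *)

Lemma wtD (q : nat) (c d : 'X_{1..q}) (A : {set 'I_q}) :
  wt (c + d)%MM A = (wt c A + wt d A)%N.
Proof. by rewrite /wt -big_split; apply: eq_bigr => i _; rewrite mnmDE. Qed.

Lemma wtM (q : nat) (c : 'X_{1..q}) (n : nat) (A : {set 'I_q}) :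
  wt (c *+ n)%MM A = (wt c A * n)%N.
Proof. by rewrite /wt big_distrl; apply: eq_bigr => i _; rewrite mulmnE. Qed.

Lemma wtU (q : nat) (i : 'I_q) (A : {set 'I_q}) : wt U_(i)%MM A = (i \in A).
Proof.
rewrite /wt; under eq_bigr do rewrite mnm1E.
case: (boolP (i \in A)) => iA; last first.
  by rewrite big1 // => j jA; case: eqP => // ij; rewrite ij jA in iA.
by rewrite (bigD1 i) //= eqxx big1 ?addn0 // => j /andP[_ /negPf]; rewrite eq_sym => ->.
Qed.

Definition wtE := (wtD, wtM, wtU).

Lemma leq_wt1 (q : nat) (c : 'X_{1..q}) (A : {set 'I_q}) (i : 'I_q) :
  i \in A -> (c i <= wt c A)%N.
Proof. by move=> iA; rewrite /wt (bigD1 i) //= leq_addr. Qed.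

Lemma wt1 (q : nat) (c : 'X_{1..q}) (i : 'I_q) : wt c [set i] = c i.
Proof. by rewrite /wt big_set1. Qed.

Lemma leq_wt_mdeg (q : nat) (c : 'X_{1..q}) (A : {set 'I_q}) : (wt c A <= mdeg c)%N.
Proof. by rewrite -(wtC c A) leq_addr. Qed.

Lemma wt_le_card (q : nat) (c : 'X_{1..q}) (A : {set 'I_q}) :
  (forall i, i \in A -> c i <= 1)%N -> (wt c A <= #|A|)%N.
Proof. by move=> c1; rewrite -sum1_card; apply: leq_sum. Qed.

Lemma wt_eq0 (q : nat) (c : 'X_{1..q}) (A : {set 'I_q}) :
  (wt c A = 0)%N <-> (forall i, i \in A -> c i = 0%N).
Proof.
split=> [c0 i iA|c0]; last exact: big1.
by apply/eqP; rewrite -leqn0 -c0 leq_wt1.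
Qed.

Lemma wtD1 (q : nat) (c : 'X_{1..q}) (A : {set 'I_q}) (i : 'I_q) :
  i \in A -> wt c A = (c i + wt c (A :\ i))%N.
Proof. exact: big_setD1. Qed.

(** The equality case of a termwise comparison of sums: this is how a failed
    separation turns into coordinates of d. *)
Lemma wt_le_eq (q : nat) (c d : 'X_{1..q}) (A : {set 'I_q}) :
  (forall i, i \in A -> d i <= c i)%N -> (wt c A <= wt d A)%N ->
  forall i, i \in A -> d i = c i.
Proof.
move=> dc cd i iA; apply/eqP; rewrite eqn_leq dc //= -(leq_add2r (wt c (A :\ i))).
rewrite -wtD1 //; apply: leq_trans cd _; rewrite (wtD1 d iA) leq_add2l.
by apply: leq_sum => j /setD1P[_ /dc].
Qed.

Lemma mnm_le_eq (q : nat) (c d : 'X_{1..q}) :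
  (forall i, c i <= d i)%N -> mdeg c = mdeg d -> d = c.
Proof.
rewrite -!wtT => cd eq_cd; apply/mnmP => i; apply/esym.
by apply: (@wt_le_eq q d c setT) => //; rewrite eq_cd.
Qed.

Definition mnm_coordE (q : nat) := (@mnmDE q, @mulmnE q, @mnm1E q).

Lemma mdeg_pos (q : nat) (c : 'X_{1..q}) : (0 < mdeg c)%N -> exists i : 'I_q, (0 < c i)%N.
Proof.
rewrite lt0n -wtT => c0; apply/existsP; apply: contraR c0; rewrite negb_exists.
by move=> /forallP c0; apply/eqP/wt_eq0 => i _; have := c0 i; lia.
Qed.

Lemma mnm_peel (q : nat) (c : 'X_{1..q}) (i : 'I_q) :
  (0 < c i)%N -> exists c', c = (U_(i) + c')%MM.
Proof.
move=> ci; exists (c - U_(i))%MM; rewrite addmC submK //; apply/mnm_lepP => j.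
by rewrite mnm1E; case: eqP => [<-|].
Qed.

Lemma mdeg1_eq (q : nat) (c : 'X_{1..q}) : mdeg c = 1%N -> exists i, c = U_(i)%MM.
Proof. by move=> /eqP/mdeg1P[i /eqP->]; exists i. Qed.

Lemma sqfree2 (q : nat) (c : 'X_{1..q}) : mdeg c = 2 -> (forall i, c i <= 1)%N ->
  exists i j : 'I_q, (i < j)%N /\ c = (U_(i) + U_(j))%MM.
Proof.
move=> c2 c1; have [|i /mnm_peel[c' def_c]] := @mdeg_pos q c; first by rewrite c2.
have [j def_c'] : exists j, c' = U_(j)%MM.
  by apply: mdeg1_eq; move: c2; rewrite def_c mdegD mdeg1; lia.
rewrite {}def_c' in def_c; case: (ltngtP i j) => [ij|ji|/val_inj ij].
- by exists i, j.
- by exists j, i; rewrite addmC.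
by have := c1 i; rewrite def_c ij !mnm_coordE eqxx.
Qed.

Lemma sqfree3 (q : nat) (c : 'X_{1..q}) : mdeg c = 3 -> (forall i, c i <= 1)%N ->
  exists i j l : 'I_q, (i < j < l)%N /\ c = (U_(i) + U_(j) + U_(l))%MM.
Proof.
move=> c3 c1; have [|i /mnm_peel[c' def_c]] := @mdeg_pos q c; first by rewrite c3.
have [j [l [jl def_c']]] : exists j l : 'I_q, (j < l)%N /\ c' = (U_(j) + U_(l))%MM.
  apply: sqfree2; first by move: c3; rewrite def_c mdegD mdeg1; lia.
  by move=> j; have := c1 j; rewrite def_c mnmDE; lia.
rewrite {}def_c' in def_c.
have ij : i != j :> nat.
  by apply/eqP => /val_inj ij; have := c1 i; rewrite def_c ij !mnm_coordE eqxx; lia.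
have il : i != l :> nat.
  by apply/eqP => /val_inj il; have := c1 i; rewrite def_c il !mnm_coordE eqxx; lia.
have [lt_ij|le_ji] := ltnP i j.
  by exists i, j, l; rewrite lt_ij jl def_c addmA.
have [lt_il|le_li] := ltnP i l.
  by exists j, i, l; rewrite def_c addmA [(U_(j) + _)%MM]addmC; split; first lia.
by exists j, l, i; rewrite def_c addmC; split; first lia.
Qed.

Lemma mdeg_le_card (q : nat) (c : 'X_{1..q}) (a : 'I_q) :
  (forall i, i != a -> c i <= 1)%N -> (mdeg c <= c a + q.-1)%N.
Proof.
move=> ci; rewrite -(wtC c [set a]) wt1 leq_add2l.
rewrite -[q in q.-1]card_ord -(cardsC1 a).
by apply: wt_le_card => i; rewrite !inE => /ci.
Qed.

Lemma square_eq (q : nat) (c : 'X_{1..q}) (a : 'I_q) : mdeg c = 3 -> c a = 2 ->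
  exists2 b, b != a & c = (U_(a) *+ 2 + U_(b))%MM.
Proof.
move=> c3 ca2; have [|c' def_c] := @mnm_peel q c a; first by rewrite ca2.
have [|c'' def_c'] := @mnm_peel q c' a.
  by move: ca2; rewrite def_c !mnm_coordE eqxx; lia.
have [b def_c''] : exists b, c'' = U_(b)%MM.
  by apply: mdeg1_eq; move: c3; rewrite def_c def_c' !mdegD !mdeg1; lia.
exists b; last by rewrite def_c def_c' def_c'' mulmS mulm1n addmA.
by apply/eqP => ba; move: ca2; rewrite def_c def_c' def_c'' ba !mnm_coordE eqxx.
Qed.

Lemma mdeg2_eq (q : nat) (b : 'X_{1..q}) : mdeg b = 2 ->
  exists i j : 'I_q, b = (U_(i) + U_(j))%MM.
Proof.
move=> b2; have [|i /mnm_peel[c def_b]] := @mdeg_pos q b; first by rewrite b2.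
have [j def_c] : exists j, c = U_(j)%MM.
  by apply: mdeg1_eq; apply: (@addnI 1); rewrite -[in LHS](mdeg1 i) -mdegD -def_b.
by exists i, j; rewrite def_b def_c.
Qed.

Lemma mdeg_triple (q : nat) (u v w : 'I_q) : mdeg (U_(u) + U_(v) + U_(w))%MM = 3.
Proof. by rewrite !mdegD !mdeg1. Qed.

Lemma mdeg_square (q : nat) (a b : 'I_q) : mdeg (U_(a) *+ 2 + U_(b))%MM = 3.
Proof. by rewrite mdegD mdegMn !mdeg1. Qed.

Lemma two_units_le1 (q : nat) (a b i : 'I_q) : a != b -> ((a == i) + (b == i) <= 1)%N.
Proof.
move=> ab; case: (eqVneq a i) => [<-|_]; last by case: (b == i).
by rewrite eq_sym (negPf ab).
Qed.

Lemma triple_le1 (q : nat) (u v w i : 'I_q) : u != v -> u != w -> v != w ->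
  ((U_(u) + U_(v) + U_(w))%MM i <= 1)%N.
Proof.
move=> uv uw vw; rewrite !mnm_coordE.
have := two_units_le1 i uv; have := two_units_le1 i uw; have := two_units_le1 i vw.
by case: (u == i); case: (v == i); case: (w == i).
Qed.

Lemma fresh (q : nat) (A : {set 'I_q}) : (#|A| < q)%N -> exists i : 'I_q, i \notin A.
Proof.
move=> Aq; have /card_gt0P[i] : (0 < #|~: A|)%N.
  by rewrite -(ltn_add2l #|A|) addn0 cardsC card_ord.
by rewrite inE; exists i.
Qed.

Lemma fresh2 (q : nat) (A : {set 'I_q}) : (#|A|.+1 < q)%N ->
  exists i j : 'I_q, [/\ i != j, i \notin A & j \notin A].
Proof.
move=> Aq; have [|i iA] := @fresh q A; first exact: ltnW.
have [|j] := @fresh q (i |: A); first by rewrite cardsU1 iA.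
by rewrite !inE negb_or eq_sym => /andP[ij jA]; exists i, j.
Qed.

(** * The candidate facets are faces *)

Lemma UsetP (q r : nat) (b c : 'X_{1..q}) :
  reflect (mdeg c = r /\ forall i : 'I_q, (b i <= c i <= (b i).+1)%N)
          (c \in Uset r b).
Proof.
rewrite !inE /= in_Nset.
apply: (iffP andP) => -[cr cb]; split; [exact/eqP|exact/forallP|exact/eqP|exact/forallP].
Qed.

(** U_b is the translate by b of a set of squarefree vectors; the explicit lists
    of its elements are read off from this. *)
Lemma Uset_addP (q r : nat) (b c : 'X_{1..q}) :
  c \in Uset r b <->
  exists c' : 'X_{1..q}, [/\ c = (b + c')%MM, (mdeg b + mdeg c' = r)%N
                           & forall i, (c' i <= 1)%N].
Proof.
split=> [/UsetP[cr bc]|[c' [-> cr c'1]]]; last first.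
  apply/UsetP; split=> [|i]; first by rewrite mdegD.
  by rewrite mnmDE leq_addr -addn1 leq_add2l c'1.
have def_c : c = (b + (c - b))%MM.
  by rewrite addmC submK //; apply/mnm_lepP => i; case/andP: (bc i).
exists (c - b)%MM; split=> [//||i]; first by rewrite -mdegD -def_c.
by rewrite mnmBE leq_subLR addn1; case/andP: (bc i).
Qed.

(** If c_i < b_i then d_i > c_i for all d in U_b, so all d are lighter than c on
    the complement of i.  If c >= b and A is the set of the i with b_i < c_i,
    then d <= c on A; a d at least as heavy as c on A therefore agrees with c
    on A, and off A it is at least b, which is c there. *)
Lemma separated_Uset (q r : nat) (b : 'X_{1..q}) : separated r (Uset r b).
Proof.
move=> c cr.
have [/existsP[/= i ci]|] := boolP [exists i : 'I_q, c i < b i]%N.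
  pose A := [set~ i]; exists A => d /UsetP[dr db] _.
  have wtA (e : 'X_{1..q}) : mdeg e = (e i + wt e A)%N by rewrite -(wtC e [set i]) wt1.
  by have := wtA c; have := wtA d; have := db i; lia.
rewrite negb_exists => /forallP bc.
exists [set i | b i < c i]%N => d /UsetP[dr db] dc; rewrite ltnNge; apply/negP => cd.
have le_dc i : i \in [set i | b i < c i]%N -> (d i <= c i)%N.
  by rewrite inE => bci; have /andP[_ dbi] := db i; apply: leq_trans dbi _.
apply/dc/mnm_le_eq; rewrite ?dr // => i.
have [bci|cbi] := ltnP (b i) (c i).
  by rewrite (wt_le_eq le_dc cd) ?inE.
by apply: leq_trans cbi _; case/andP: (db i).
Qed.

(** Description of W_{P,a} by inequalities between coordinates: c_a tells which
    of the three families c belongs to.  The separation arguments only use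
    this form. *)
Lemma WsetP (q : nat) (P : {set 'I_q}) (a : 'I_q) (c : 'X_{1..q}) : a \in P ->
  c \in Wset P a <->
  [/\ mdeg c = 3, (c a <= 2)%N, forall i, i != a -> (c i <= 1)%N,
      c a = 2 -> forall i, i \notin P -> c i = 0%N
    & c a = 0%N -> forall i, i \in P -> c i = 0%N].
Proof.
move=> aP; split.
  rewrite !in_fsetU => /orP[/orP[]|] /imfsetP[/= t].
  - rewrite !inE => /andP[tP ta] ->; split.
    + by rewrite mdegD mdegMn !mdeg1.
    + by rewrite !mnm_coordE eqxx (negPf ta).
    + by move=> i ia; rewrite !mnm_coordE eq_sym (negPf ia); case: eqP.
    + move=> _ i iP; rewrite !mnm_coordE; case: eqP => [ai|_]; first by rewrite -ai aP in iP.
      by case: eqP => [ti|_]; first by rewrite -ti tP in iP.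
    + by rewrite !mnm_coordE eqxx.
  - case: t => [[i j] l] /=; rewrite !inE => /and4P[/andP[/= ij jl] iP jP lP] ->.
    have out x : x \in P -> (U_(i) + U_(j) + U_(l))%MM x = 0%N.
      by move=> xP; rewrite !mnm_coordE; do 3 ![case: eqP => [E|_]; first by rewrite -E ?(negPf iP) ?(negPf jP) ?(negPf lP) in xP].
    split.
    + by rewrite !mdegD !mdeg1.
    + by rewrite out.
    + move=> x _; rewrite !mnm_coordE.
      do 3 ![case: eqP => [?|_] //]; subst; lia.
    + by rewrite out.
    + by move=> _ x /out.
  - case: t => [j l] /=; rewrite !inE => /and3P[/= jl aj al] ->.
    have ca : (U_(a) + U_(j) + U_(l))%MM a = 1%N.
      by rewrite !mnm_coordE eqxx ![_ == a]eq_sym (negPf aj) (negPf al).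
    split; rewrite ?ca //.
    + by rewrite !mdegD !mdeg1.
    + move=> x xa; rewrite !mnm_coordE eq_sym (negPf xa).
      do 2 ![case: eqP => [?|_] //]; subst; lia.
case=> c3 ca ci out2 out0; rewrite !in_fsetU.
have [ca0|ca_gt0] := posnP (c a).
  have c1 i : (c i <= 1)%N by have [->|/ci//] := eqVneq i a; rewrite ca0.
  have [i [j [l [ijl def_c]]]] := sqfree3 c3 c1.
  have supp x : (0 < c x)%N -> x \notin P by apply: contraL => /(out0 ca0)->.
  apply/orP; left; apply/orP; right; apply/imfsetP; exists (i, j, l) => //=.
  rewrite !inE /= ijl !supp // def_c !mnm_coordE eqxx; lia.
have [c' def_c] := mnm_peel ca_gt0.
have c'2 : mdeg c' = 2 by move: c3; rewrite def_c mdegD mdeg1; lia.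
have [ca2|ca1] : c a = 2 \/ c a = 1%N by lia.
  have : (0 < c' a)%N by move: ca2; rewrite def_c !mnm_coordE eqxx; lia.
  move=> /mnm_peel[c'' def_c'].
  have [j def_c''] : exists j, c'' = U_(j)%MM.
    by apply: mdeg1_eq; move: c'2; rewrite def_c' mdegD mdeg1; lia.
  rewrite {}def_c'' in def_c'; rewrite {}def_c' in def_c.
  have ja : j != a.
    by apply/eqP => ja; move: ca2; rewrite def_c ja !mnm_coordE eqxx.
  apply/orP; left; apply/orP; left; apply/imfsetP; exists j => /=; last first.
    by rewrite def_c mulmS mulm1n addmA.
  rewrite !inE ja andbT; apply: contraT => /(out2 ca2).
  by rewrite def_c !mnm_coordE eqxx; lia.
have c'i i : (c' i <= 1)%N.
  have [->|/ci] := eqVneq i a; last by rewrite def_c mnmDE; lia.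
  by move: ca1; rewrite def_c !mnm_coordE eqxx; lia.
have [j [l [jl def_c']]] := sqfree2 c'2 c'i.
apply/orP; right; apply/imfsetP; exists (j, l) => /=; last by rewrite def_c def_c' addmA.
by rewrite !inE /= jl; move: ca1; rewrite def_c def_c' !mnm_coordE eqxx ![_ == a]eq_sym; lia.
Qed.

(** A coordinate of c that no element of W_{P,a} attains separates by itself.
    Otherwise let A be the support of c. If d is not lighter than c on A then d
    is supported in A, and d = c unless d_a = 2 and c_a = 1. In that case the
    support of d is contained in P and, d having degree 3, has an element y
    other than a, which is also in the support of c. When there is such a y, the
    support of c without a separates instead: a d which is not lighter has d_y >
    0, hence d_a > 0 by definition of W_{P,a}, so d >= c. *)
Lemma separated_Wset (q : nat) (P : {set 'I_q}) (a : 'I_q) : a \in P ->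
  separated 3 (Wset P a).
Proof.
move=> aP c c3.
(* On W_{P,a} the coordinate at x is at most 2 if x = a and at most 1 otherwise. *)
have [/existsP[/= x cx]|] := boolP [exists x : 'I_q, (x == a).+1 < c x]%N.
  exists [set x] => d /(WsetP _ aP)[_ da di _ _] _; rewrite !wt1.
  by apply: leq_ltn_trans cx; case: eqP => [->//|/eqP/di].
rewrite negb_exists => /forallP c_small.
have ca : (c a <= 2)%N by have := c_small a; rewrite eqxx; lia.
have ci i : i != a -> (c i <= 1)%N by move=> /negPf ia; have := c_small i; rewrite ia; lia.
have [/existsP[/= y /and4P[/eqP ca1 yP ya cy]]|] :=
    boolP [exists y : 'I_q, [&& c a == 1, y \in P, y != a & 0 < c y]]%N.
  exists [set i | (i != a) && (0 < c i)%N] => d /(WsetP _ aP)[d3 da di _ d0] dc.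
  rewrite ltnNge; apply/negP => cd; apply/dc/mnm_le_eq; last by rewrite d3.
  have eq_dc i : i != a -> (0 < c i)%N -> d i = c i.
    move=> ia ci0; apply: (wt_le_eq _ cd); last by rewrite inE ia.
    by move=> j; rewrite inE => /andP[/di + +]; lia.
  have da_gt0 : (0 < d a)%N.
    by case: (posnP (d a)) => // /d0/(_ y yP) dy; move: (cy); rewrite -(eq_dc y ya cy) dy.
  move=> i; have [->|ia] := eqVneq i a; first by rewrite ca1.
  by have [->//|/(eq_dc _ ia)->] := posnP (c i).
rewrite negb_exists => /forallP no_y.
pose A := [set i | 0 < c i]%N; exists A => d /(WsetP _ aP)[d3 da di d2 _] dc.
rewrite ltnNge; apply/negP => cd; apply: dc; apply/esym/mnm_le_eq; last by rewrite d3.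
have cA : wt c (~: A) = 0%N by apply/wt_eq0 => i; rewrite !inE; lia.
have dA i : c i = 0%N -> d i = 0%N.
  move=> ci0; have /wt_eq0 -> // : wt d (~: A) = 0%N.
    apply/eqP; rewrite -leqn0 -(leq_add2l (wt d A)) wtC addn0 d3 -c3.
    by rewrite -(wtC c A) cA addn0.
  by rewrite !inE ci0.
move=> i; have [/dA->//|ci0] := posnP (c i).
have [->|/di] := eqVneq i a; last by lia.
rewrite leqNgt; apply/negP => lt_cd.
have [da2 ca1] : d a = 2 /\ c a = 1%N.
  by have [/dA|] := posnP (c a); lia.
have dz : wt d [set~ a] = 0%N.
  apply/wt_eq0 => j; rewrite !inE => ja; have [jP|/(d2 da2)//] := boolP (j \in P).
  by apply: dA; have := no_y j; rewrite ca1 jP ja /=; lia.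
by have := wtC d [set a]; rewrite wt1 dz d3 da2.
Qed.

(** The lower bounds q >= 2 and q >= 5 of the corresponding types follow from
    a != b and from the bounds on P. *)
Variant listed_facet (q : nat) : {fset 'X_{1..q}} -> Prop :=
| FacetCube (a : 'I_q) : listed_facet (Uset 3 (U_(a) *+ 2)%MM)
| FacetPair (a b : 'I_q) of a != b : listed_facet (Uset 3 (U_(a) + U_(b))%MM)
| FacetStar (a : 'I_q) of (3 <= q)%N : listed_facet (Uset 3 U_(a)%MM)
| FacetSqfree of (4 <= q)%N : listed_facet (Uset 3 (0%MM : 'X_{1..q}))
| FacetW (P : {set 'I_q}) (a : 'I_q) of
    (2 <= #|P|)%N & (#|P| <= q - 3)%N & a \in P : listed_facet (Wset P a).

Lemma listed_separated (q : nat) (F : {fset 'X_{1..q}}) :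
  listed_facet F -> F `<=` Nset q 3 /\ separated 3 F.
Proof.
case=> [a|a b _|a _|_|P a _ _ aP].
1-4: by split; [apply/fsubsetP => c /UsetP[c3 _]; rewrite in_Nset c3 | apply: separated_Uset].
split; last exact: separated_Wset.
by apply/fsubsetP => c /(WsetP _ aP)[c3 _ _ _ _]; rewrite in_Nset c3.
Qed.

(** If at most two indices lie outside P, a squarefree triple cannot avoid P, so
    all elements involve a. *)
Lemma Wset_covered (q : nat) (P : {set 'I_q}) (a : 'I_q) :
  a \in P -> (2 <= #|P|)%N -> exists2 F, listed_facet F & Wset P a `<=` F.
Proof.
move=> aP P2; have [P_small|P_big] := leqP #|P| (q - 3).
  by exists (Wset P a) => //; apply: FacetW.
have Pq : (#|P| + #|~: P| = q)%N by rewrite cardsC card_ord.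
have da_gt0 d : d \in Wset P a -> (0 < d a)%N.
  move=> /(WsetP _ aP)[d3 _ di _ d0]; rewrite lt0n; apply/eqP => da0.
  have dP : wt d P = 0%N by apply/wt_eq0 => i; apply: d0.
  have dPC : (wt d (~: P) <= #|~: P|)%N.
    by apply: wt_le_card => i; rewrite inE => iP; apply: di; apply: contraNneq iP => ->.
  by have := wtC d P; lia.
have [q3|q2] := leqP 3 q.
  exists (Uset 3 U_(a)%MM); first exact: FacetStar.
  apply/fsubsetP => d dW; have := da_gt0 d dW.
  move: dW => /(WsetP _ aP)[d3 da di _ _] da0; apply/UsetP; split=> // i.
  by rewrite mnm1E eq_sym; case: eqP => [->|/eqP/di]; lia.
(* Here q = 2, so P is everything and d is a square of centre a. *)
exists (Uset 3 (U_(a) *+ 2)%MM); first exact: FacetCube.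
apply/fsubsetP => d /(WsetP _ aP)[d3 da di _ _]; apply/UsetP; split=> // i.
have := mdeg_le_card di.
by rewrite mulmnE mnm1E eq_sym; case: eqP => [->|/eqP/di]; lia.
Qed.

(** * Every face lies in a candidate facet *)

(** Given 3e_a and some d with i <> a in its support, the vector 2e_a + e_i can be
    separated from both only if it is d. *)
Lemma cube_face (q : nat) (s : {fset 'X_{1..q}}) (d0 : 'X_{1..q}) (a : 'I_q) :
  s `<=` Nset q 3 -> separated 3 s -> d0 \in s -> d0 a = 3 ->
  s `<=` Uset 3 (U_(a) *+ 2)%MM.
Proof.
move=> /fsubsetP sN sep_s d0s d0a; apply/fsubsetP => d ds.
have /eqP d3 : mdeg d == 3 by rewrite -in_Nset sN.
apply/UsetP; split=> //.
have [/existsP[/= i /andP[ia di]]|] := boolP [exists i : 'I_q, (i != a) && (0 < d i)]%N.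
  have [A sepA] := sep_s _ (mdeg_square a i).
  have [->|/eqP dc] := eqVneq d (U_(a) *+ 2 + U_(i))%MM.
    move=> j; rewrite !mnm_coordE; case: (a =P j) => [<-|_]; last by case: eqP.
    by rewrite (negPf ia).
  have d0c : d0 <> (U_(a) *+ 2 + U_(i))%MM.
    by move=> E; move: d0a; rewrite E !mnm_coordE eqxx (negPf ia).
  have := sepA d ds dc; have := sepA d0 d0s d0c; rewrite !wtE.
  have := @leq_wt1 q d0 A a; rewrite d0a; have := @leq_wt1 q d A i.
  case: (a \in A); case: (i \in A) => /=.
  - by move=> _ /(_ isT) le3 lt3; have := leq_trans lt3 le3; rewrite ltnn.
  - by move=> _ /(_ isT) le3 lt3; have := leq_trans lt3 (ltnW le3); rewrite ltnn.
  - by move=> /(_ isT) di1 _ _ d1; have := leq_ltn_trans di1 d1; rewrite ltnNge di.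
  - by [].
rewrite negb_exists => /forallP d0i j.
have d0j (i : 'I_q) : i != a -> d i = 0%N by move=> ia; have := d0i i; rewrite ia; case: (d i).
have da : d a = 3.
  by rewrite -d3 -(wtC d [set a]) wt1 (_ : wt d _ = 0%N) ?addn0 //; apply/wt_eq0 => i; rewrite !inE => /d0j.
rewrite !mnm_coordE; case: (a =P j) => [<-|/eqP]; first by rewrite da.
by rewrite eq_sym => /d0j->.
Qed.

(** If y and z were distinct, e_x + e_y + e_z could not be separated from both
    squares: a separating A would have to contain z and not x because of the
    first, and then the second is too heavy. *)
Lemma crossing_squares (q : nat) (s : {fset 'X_{1..q}}) (x y z w : 'I_q) :
  separated 3 s -> (U_(x) *+ 2 + U_(y))%MM \in s -> (U_(z) *+ 2 + U_(w))%MM \in s ->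
  x != z -> y = z.
Proof.
move=> sep_s sx sz xz; apply/eqP; apply: contraT => yz.
have [A sepA] := sep_s _ (mdeg_triple x y z).
have nx : (U_(x) *+ 2 + U_(y))%MM <> (U_(x) + U_(y) + U_(z))%MM.
  by move=> /mnmP/(_ z); rewrite !mnm_coordE eqxx (negPf xz) (negPf yz).
have nz : (U_(z) *+ 2 + U_(w))%MM <> (U_(x) + U_(y) + U_(z))%MM.
  by move=> /mnmP/(_ z); rewrite !mnm_coordE eqxx (negPf xz) (negPf yz); case: (w == z).
have := sepA _ sx nx; have := sepA _ sz nz; rewrite !wtE.
by case: (x \in A); case: (y \in A); case: (z \in A); case: (w \in A).
Qed.

(** If d has i outside of {a, c} in its support, then e_a + e_c + e_i can be
    separated from d and both squares only if it is d. *)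
Lemma two_centres_face (q : nat) (s : {fset 'X_{1..q}}) (a c : 'I_q) :
  s `<=` Nset q 3 -> separated 3 s ->
  (forall (d : 'X_{1..q}) i, d \in s -> d i <= 2)%N -> a != c ->
  (U_(a) *+ 2 + U_(c))%MM \in s -> (U_(c) *+ 2 + U_(a))%MM \in s ->
  s `<=` Uset 3 (U_(a) + U_(c))%MM.
Proof.
move=> /fsubsetP sN sep_s le2 ac sa sc; apply/fsubsetP => d ds.
have /eqP d3 : mdeg d == 3 by rewrite -in_Nset sN.
apply/UsetP; split=> //.
have [/existsP[/= i /and3P[ia ic di]]|] :=
    boolP [exists i : 'I_q, [&& i != a, i != c & 0 < d i]]%N.
  have [A sepA] := sep_s _ (mdeg_triple a c i).
  have [->|/eqP dn] := eqVneq d (U_(a) + U_(c) + U_(i))%MM.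
    by move=> j; rewrite !mnm_coordE leq_addr -addn1 leq_add2l; case: eqP.
  have na : (U_(a) *+ 2 + U_(c))%MM <> (U_(a) + U_(c) + U_(i))%MM.
    by move=> /mnmP/(_ a); rewrite !mnm_coordE eqxx (eq_sym c) (negPf ac) (negPf ia).
  have nc : (U_(c) *+ 2 + U_(a))%MM <> (U_(a) + U_(c) + U_(i))%MM.
    by move=> /mnmP/(_ c); rewrite !mnm_coordE eqxx (negPf ac) (negPf ic).
  have := sepA d ds dn; have := sepA _ sa na; have := sepA _ sc nc.
  rewrite !wtE; have := @leq_wt1 q d A i.
  case: (a \in A); case: (c \in A); case: (i \in A) => //= /(_ isT) di1 _ _ d1.
  by have := leq_ltn_trans di1 d1; rewrite ltnNge di.
rewrite negb_exists => /forallP no_i j.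
have d0 (i : 'I_q) : i != a -> i != c -> d i = 0%N.
  by move=> ia ic; have := no_i i; rewrite ia ic; case: (d i).
have dac : (d a + d c = 3)%N.
  have dz : wt d ([set~ a] :\ c) = 0%N.
    by apply/wt_eq0 => i; rewrite !inE => /andP[ic ia]; apply: d0.
  have cA : c \in [set~ a] by rewrite !inE eq_sym.
  by rewrite -d3 -(wtC d [set a]) wt1 (wtD1 d cA) dz addn0.
have ca : (c == a) = false by rewrite eq_sym (negPf ac).
move: dac (le2 d a ds) (le2 d c ds); rewrite !mnm_coordE.
have [<-|aj] := eqVneq a j.
  by rewrite ca; case: (d a) (d c) => [|[|[|?]]] [|[|[|?]]].
have [<-|cj] := eqVneq c j; first by case: (d a) (d c) => [|[|[|?]]] [|[|[|?]]].
by have -> : d j = 0%N by apply: d0; rewrite eq_sym.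
Qed.

(** Here P consists of a and the other ends of the squares.  A triple
    e_i + e_j + e_l avoiding a with i in P would, together with 2e_a + e_i,
    leave no separating set for e_a + e_i + e_j. *)
Lemma one_centre_face (q : nat) (s : {fset 'X_{1..q}}) (a b : 'I_q) :
  s `<=` Nset q 3 -> separated 3 s ->
  (forall (d : 'X_{1..q}) i, d \in s -> d i <= 2)%N ->
  (forall (d : 'X_{1..q}) i, d \in s -> i != a -> d i <= 1)%N ->
  b != a -> (U_(a) *+ 2 + U_(b))%MM \in s ->
  exists P : {set 'I_q}, [/\ a \in P, (2 <= #|P|)%N & s `<=` Wset P a].
Proof.
move=> /fsubsetP sN sep_s le2 le1 ba sb.
pose P := [set j | (j == a) || ((U_(a) *+ 2 + U_(j))%MM \in s)].
have aP : a \in P by rewrite inE eqxx.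
have bP : b \in P by rewrite inE sb orbT.
exists P; split=> //.
  have /subset_leq_card : [set a; b] \subset P by apply/subsetP => x /set2P[]->.
  by rewrite cards2 eq_sym ba.
apply/fsubsetP => d ds.
have /eqP d3 : mdeg d == 3 by rewrite -in_Nset sN.
apply/(WsetP _ aP); split=> //; [exact: le2|by move=> i; apply: le1| |].
  move=> da2 i iP; have [j ja def_d] := square_eq d3 da2.
  have jP : j \in P by rewrite inE -def_d ds orbT.
  rewrite def_d !mnm_coordE; case: eqP => [ai|_]; first by rewrite -ai aP in iP.
  by case: eqP => // ji; rewrite -ji jP in iP.
move=> da0 i iP; apply/eqP; rewrite -leqn0 leqNgt; apply/negP => di.
have ia : i != a by apply: contraTneq di => ->; rewrite da0.
have sqi : (U_(a) *+ 2 + U_(i))%MM \in s by move: iP; rewrite inE (negPf ia).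
have [d' def_d] := mnm_peel di.
have [|j /mnm_peel[d'' def_d']] := @mdeg_pos q d'.
  by rewrite -(ltn_add2l 1) -[1%N in ltnRHS](mdeg1 i) -mdegD -def_d d3.
rewrite {}def_d' in def_d.
have ja : j != a by apply/eqP => ja; move: da0; rewrite def_d ja !mnm_coordE eqxx addnCA.
have [A sepA] := sep_s _ (mdeg_triple a i j).
have n0 : (U_(a) *+ 2 + U_(i))%MM <> (U_(a) + U_(i) + U_(j))%MM.
  by move=> /mnmP/(_ a); rewrite !mnm_coordE eqxx (negPf ia) (negPf ja).
have nd : d <> (U_(a) + U_(i) + U_(j))%MM.
  by move=> E; move: da0; rewrite E !mnm_coordE eqxx.
have := sepA _ ds nd; have := sepA _ sqi n0; rewrite def_d !wtE.
by case: (a \in A); case: (i \in A); case: (j \in A).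
Qed.

Lemma sqfree_face (q : nat) (s : {fset 'X_{1..q}}) : (0 < q)%N ->
  s `<=` Nset q 3 -> (forall (d : 'X_{1..q}) i, d \in s -> d i <= 1)%N ->
  exists2 F, listed_facet F & s `<=` F.
Proof.
move=> q_gt0 /fsubsetP sN le1.
have s3 (d : 'X_{1..q}) : d \in s -> mdeg d = 3.
  by move=> ds; apply/eqP; rewrite -in_Nset sN.
(* For q = 3 the set U_0 is a single triple, contained in every U_{e_a}; for q < 3
   it is empty. *)
have [q4|q3] := leqP 4 q.
  exists (Uset 3 0%MM); first exact: FacetSqfree.
  apply/fsubsetP => d ds; apply/UsetP; split=> [|i]; first exact: s3.
  by rewrite mnm0E le1.
pose a : 'I_q := Ordinal q_gt0.
have le_q (d : 'X_{1..q}) : d \in s -> (3 <= d a + q.-1)%N.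
  by move=> ds; rewrite -(s3 d ds); apply: mdeg_le_card => i _; apply: le1.
have [q3'|q2] := leqP 3 q.
  exists (Uset 3 U_(a)%MM); first exact: FacetStar.
  apply/fsubsetP => d ds; apply/UsetP; split=> [|i]; first exact: s3.
  have := le_q d ds; have := le1 d a ds; rewrite mnm1E; case: eqP => [<-|_]; first lia.
  by move=> _ _; rewrite le1.
exists (Uset 3 (U_(a) *+ 2)%MM); first exact: FacetCube.
by apply/fsubsetP => d ds; have := le_q d ds; have := le1 d a ds; lia.
Qed.

Lemma separated_in_facet (q : nat) (s : {fset 'X_{1..q}}) : (0 < q)%N ->
  s `<=` Nset q 3 -> separated 3 s -> exists2 F, listed_facet F & s `<=` F.
Proof.
move=> q_gt0 sN sep_s.
have s3 (d : 'X_{1..q}) : d \in s -> mdeg d = 3.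
  by move=> ds; apply/eqP; rewrite -in_Nset (fsubsetP sN).
have bound m (T : pred 'I_q) : (forall d : 'X_{1..q}, d \in s -> forall i, T i -> d i <= m.+1)%N ->
    (forall (d : 'X_{1..q}) i, d \in s -> T i -> d i <= m)%N \/
    exists (d : 'X_{1..q}) (i : 'I_q), [/\ d \in s, T i & d i = m.+1].
  move=> le_m1; have [|] := boolP (has (fun d : 'X_{1..q} => [exists i : 'I_q, T i && (d i == m.+1)]) s).
    by move=> /hasP[d ds /existsP[i /andP[Ti /eqP di]]]; right; exists d, i.
  move=> /hasPn no_d; left=> d i ds Ti; rewrite -ltnS ltn_neqAle le_m1 // andbT.
  by have := no_d d ds; rewrite negb_exists => /forallP/(_ i); rewrite Ti.
have [d ds i _|le2|[d0 [a [d0s _ d0a]]]] := @bound 2 predT.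
- by rewrite -(s3 d ds) -wt1 leq_wt_mdeg.
- have {}le2 (d : 'X_{1..q}) (i : 'I_q) : d \in s -> (d i <= 2)%N by move=> ds; apply: le2.
  have [d ds i _|le1|[d0 [a [d0s _ d0a]]]] := @bound 1 predT.
  + exact: le2.
  + by apply: sqfree_face => // d i ds; apply: le1.
  have [b ba def_d0] := square_eq (s3 d0 d0s) d0a; rewrite {}def_d0 in d0s.
  have [d ds i _|le1|[d1 [c [d1s ca d1c]]]] := @bound 1 (predC1 a).
  + exact: le2.
  + have [P [aP P2 sW]] := one_centre_face sN sep_s le2 le1 ba d0s.
    by have [F LF WF] := Wset_covered aP P2; exists F => //; apply: fsubset_trans WF.
  have [e ec def_d1] := square_eq (s3 d1 d1s) d1c; rewrite {}def_d1 in d1s.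
  have ac : a != c by rewrite eq_sym.
  have bc := crossing_squares sep_s d0s d1s ac; have ea := crossing_squares sep_s d1s d0s ca.
  subst b e; exists (Uset 3 (U_(a) + U_(c))%MM); first exact: FacetPair.
  exact: two_centres_face.
exists (Uset 3 (U_(a) *+ 2)%MM); first exact: FacetCube.
exact: cube_face d0a.
Qed.

(** * The candidate facets are pairwise incomparable *)

Lemma facet_of_cube (q : nat) (F : {fset 'X_{1..q}}) (c : 'X_{1..q}) (a : 'I_q) :
  listed_facet F -> c \in F -> c a = 3 -> F = Uset 3 (U_(a) *+ 2)%MM.
Proof.
case=> [x|x y xy|x _|_|P x _ _ xP].
- move=> /UsetP[_ /(_ a)]; rewrite mulmnE mnm1E; case: eqP => [->//|_] /=; lia.
- move=> /UsetP[_ /(_ a)]; rewrite !mnm_coordE; case: eqP => [<-|_] /=; last by case: eqP => _ /=; lia.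
  by rewrite eq_sym (negPf xy); lia.
- by move=> /UsetP[_ /(_ a)]; rewrite mnm1E; case: eqP => _ /=; lia.
- by move=> /UsetP[_ /(_ a)]; rewrite mnm0E; lia.
by move=> /(WsetP _ xP)[_ cx ci _ _]; case: (eqVneq a x) => [->|/ci]; lia.
Qed.

(** A square has the coordinate 2 at a, which forces a to be the distinguished
    index of the set or one of its two indices. *)
Lemma facets_of_square (q : nat) (F : {fset 'X_{1..q}}) (a b : 'I_q) :
  listed_facet F -> (U_(a) *+ 2 + U_(b))%MM \in F -> a != b ->
  [\/ F = Uset 3 (U_(a) *+ 2)%MM, F = Uset 3 (U_(a) + U_(b))%MM,
      F = Uset 3 U_(a)%MM
    | exists P : {set 'I_q}, [/\ (#|P| <= q - 3)%N, a \in P, b \in P & F = Wset P a]].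
Proof.
move=> LF + ab; case: LF => [x|x y xy|x _|_|P x _ Pq xP].
- move=> /UsetP[_ /(_ x)]; rewrite !mnm_coordE eqxx; case: (a =P x) => [->|_]; first by constructor 1.
  by case: (b == x).
- move=> /UsetP[_ cE]; constructor 2; congr Uset.
  have := cE a; have := cE x; have := cE y.
  rewrite !mnm_coordE !eqxx (eq_sym y x) (negPf xy) (eq_sym x a) (eq_sym y a) (eq_sym b a) (negPf ab).
  case: (eqVneq a x) => [->|_]; first by rewrite (negPf xy); case: (eqVneq b y) => [->|].
  case: (eqVneq a y) => [->|_]; last by case: (b == x); case: (b == y).
  by case: (eqVneq b x) => [->|]; rewrite ?(addmC U_(x)%MM).
- move=> /UsetP[_ /(_ a)]; rewrite !mnm_coordE eqxx [b == a]eq_sym (negPf ab).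
  by case: eqP => [-> _|_ //]; constructor 3.
- by move=> /UsetP[_ /(_ a)]; rewrite !mnm_coordE mnm0E eqxx.
move=> /(WsetP _ xP)[_ cx ci c2 _]; constructor 4.
have xa : x = a.
  by apply/eqP; apply: contraT; rewrite eq_sym => /ci; rewrite !mnm_coordE eqxx.
subst x; exists P; split => //; apply: contraT => /c2.
by rewrite !mnm_coordE !eqxx [b == a]eq_sym (negPf ab) => /(_ erefl).
Qed.

Lemma Wset_triple (q : nat) (P : {set 'I_q}) (a u v w : 'I_q) : a \in P ->
  u \notin P -> v \notin P -> w \notin P -> u != v -> u != w -> v != w ->
  (U_(u) + U_(v) + U_(w))%MM \in Wset P a.
Proof.
move=> aP uP vP wP uv uw vw.
have c0 i : i \in P -> (U_(u) + U_(v) + U_(w))%MM i = 0%N.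
  move=> iP; have ne x : x \notin P -> (x == i) = false by apply: contraNF => /eqP->.
  by rewrite !mnm_coordE !ne.
apply/(WsetP _ aP); split; rewrite ?mdeg_triple ?c0 //.
by move=> i _; apply: triple_le1.
Qed.

(** Each listed set contains elements that leave few sets to contain it: a cube
    for the first type, squares for the second, third and fifth (where triples
    avoiding a then determine P).  For U_0, which
    has triples only, each index is avoided by one of its triples; W_{Q,x}
    moreover misses those triples that avoid x and meet Q. *)
Lemma listed_antichain (q : nat) (F G : {fset 'X_{1..q}}) :
  listed_facet F -> listed_facet G -> F `<=` G -> G = F.
Proof.
move=> LF LG /fsubsetP; case: LF => [a|a b ab|a q3|q4|P a P2 Pq aP] FG.
- apply: (facet_of_cube LG (c := (U_(a) *+ 3)%MM)); last by rewrite mulmnE mnm1E eqxx.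
  apply/FG/UsetP; split=> [|j]; first by rewrite mdegMn mdeg1.
  by rewrite !mulmnE mnm1E; case: eqP.
- have ab1 : (U_(a) *+ 2 + U_(b))%MM \in G.
    apply/FG/UsetP; split=> [|j]; first exact: mdeg_square.
    by rewrite !mnm_coordE; have := two_units_le1 j ab; case: (a == j); case: (b == j).
  have : (U_(b) *+ 2 + U_(a))%MM \in G.
    apply/FG/UsetP; split=> [|j]; first exact: mdeg_square.
    by rewrite !mnm_coordE; have := two_units_le1 j ab; case: (a == j); case: (b == j).
  have [->|->//|->|[Q [_ aQ _ ->]]] := facets_of_square LG ab1 ab.
  + by move=> /UsetP[_ /(_ a)]; rewrite !mnm_coordE eqxx eq_sym (negPf ab).
  + by move=> /UsetP[_ /(_ b)]; rewrite !mnm_coordE eqxx (negPf ab).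
  move=> /(WsetP _ aQ)[_ _ /(_ b)]; rewrite eq_sym ab => /(_ isT).
  by rewrite !mnm_coordE eqxx.
- have sq_G b : a != b -> (U_(a) *+ 2 + U_(b))%MM \in G.
    move=> ab; apply/FG/UsetP; split=> [|j]; first exact: mdeg_square.
    by rewrite !mnm_coordE; have := two_units_le1 j ab; case: (a == j); case: (b == j).
  have [|b [c [bc]]] := @fresh2 q [set a]; first by rewrite cards1.
  rewrite !inE ![_ == a]eq_sym => ab ac.
  have : (U_(a) + U_(b) + U_(c))%MM \in G.
    apply/FG/UsetP; split=> [|j]; first exact: mdeg_triple.
    have := triple_le1 j ab ac bc; rewrite !mnm_coordE.
    by case: (a == j); case: (b == j); case: (c == j).
  have [->|GE|->//|[Q [Qq aQ _ GE]]] := facets_of_square LG (sq_G b ab) ab.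
  + by move=> /UsetP[_ /(_ a)]; rewrite !mnm_coordE eqxx ![_ == a]eq_sym (negPf ab) (negPf ac).
  + move=> _; have := sq_G c ac; rewrite GE => /UsetP[_ /(_ b)].
    by rewrite !mnm_coordE eqxx (negPf ab) [c == b]eq_sym (negPf bc).
  have [|i iQ] := @fresh q Q; first by lia.
  have ai : a != i by apply: contraNneq iQ => <-.
  move=> _; have := sq_G i ai; rewrite GE => /(WsetP _ aQ)[_ _ _ /(_ _ i iQ)].
  by rewrite !mnm_coordE !eqxx [i == a]eq_sym (negPf ai) => /(_ erefl).
(* Since q > 3, a triple through y can avoid x. *)
- have tri x y : x != y -> exists u v : 'I_q,
      [/\ (U_(y) + U_(u) + U_(v))%MM \in G, (U_(y) + U_(u) + U_(v))%MM x = 0%N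
        & forall i, (U_(y) + U_(u) + U_(v))%MM i <= 1]%N.
    move=> xy; have [|u [v [uv]]] := @fresh2 q [set x; y]; first by rewrite cards2 xy.
    rewrite !inE !negb_or => /andP[ux uy] /andP[vx vy]; exists u, v.
    have le1 i := @triple_le1 q y u v i.
    rewrite ![_ == y]eq_sym in uy vy; split; last by move=> i; apply: le1.
      by apply/FG/UsetP; split=> [|i]; rewrite ?mdeg_triple // mnm0E le1.
    by rewrite !mnm_coordE (negPf ux) (negPf vx) [y == x]eq_sym (negPf xy).
  have avoid x : exists2 c, c \in G & (c x = 0%N).
    have [|y] := @fresh q [set x]; first by rewrite cards1; lia.
    by rewrite inE eq_sym => /tri[u [v [cG cx _]]]; exists (U_(y) + U_(u) + U_(v))%MM.
  case: LG tri avoid {FG} => [x|x y _|x _|//|Q x Q2 Qq xQ] tri avoid.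
  + by have [c /UsetP[_ /(_ x)]] := avoid x; rewrite !mnm_coordE eqxx => /andP[+ _] cx; rewrite cx.
  + by have [c /UsetP[_ /(_ x)]] := avoid x; rewrite !mnm_coordE eqxx => /andP[+ _] cx; rewrite cx.
  + by have [c /UsetP[_ /(_ x)]] := avoid x; rewrite !mnm_coordE eqxx => /andP[+ _] cx; rewrite cx.
  have [y yx yQ] : exists2 y, y != x & y \in Q.
    have /card_gt0P[y] : (0 < #|Q :\ x|)%N by move: Q2; rewrite (cardsD1 x Q) xQ.
    by rewrite !inE => /andP[yx yQ]; exists y.
  rewrite eq_sym in yx; have [u [v [cG cx _]]] := tri x y yx.
  have /(WsetP _ xQ)[_ _ _ _ /(_ cx y yQ)] := cG.
  by rewrite !mnm_coordE eqxx.
have sq_G b : b \in P -> b != a -> (U_(a) *+ 2 + U_(b))%MM \in G.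
  move=> bP ba; apply/FG/WsetP => //; split; rewrite ?mdeg_square //.
  - by rewrite !mnm_coordE eqxx (negPf ba).
  - by move=> i; rewrite eq_sym => ai; rewrite !mnm_coordE (negPf ai); case: eqP.
  - move=> _ i iP; rewrite !mnm_coordE; case: eqP => [ai|_]; first by rewrite -ai aP in iP.
    by case: eqP => // bi; rewrite -bi bP in iP.
  by rewrite !mnm_coordE eqxx.
have tri_G i : i \notin P -> exists u v : 'I_q,
    (U_(i) + U_(u) + U_(v))%MM \in G /\ (U_(i) + U_(u) + U_(v))%MM a = 0%N.
  move=> iP; have [|u [v [uv]]] := @fresh2 q (i |: P); first by rewrite cardsU1 iP; lia.
  rewrite !inE !negb_or ![_ == i]eq_sym => /andP[iu uP] /andP[iv vP]; exists u, v.
  have cW : (U_(i) + U_(u) + U_(v))%MM \in Wset P a by apply: Wset_triple.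
  split; first exact: FG.
  have ne x : x \notin P -> (x == a) = false by apply: contraNF => /eqP->.
  by rewrite !mnm_coordE !ne.
have [b bP ba] : exists2 b, b \in P & b != a.
  have /card_gt0P[b] : (0 < #|P :\ a|)%N by move: P2; rewrite (cardsD1 a P) aP.
  by rewrite !inE => /andP[ba bP]; exists b.
have [|i iP] := @fresh q P; first by lia.
have ab : a != b by rewrite eq_sym.
have [u [v [cG ca]]] := tri_G i iP.
have [GE|GE|GE|[Q [_ aQ bQ GE]]] := facets_of_square LG (sq_G b bP ba) ab.
1-3: by move: cG; rewrite GE => /UsetP[_ /(_ a)]; rewrite ca ?mnmDE ?mulmnE mnm1E eqxx.
rewrite GE; congr (Wset _ a); apply/setP => j; apply/idP/idP => [jQ|jP].
  apply: contraT => /tri_G[x [y []]]; rewrite GE => /(WsetP _ aQ)[_ _ _ _ c0 /c0/(_ j jQ)].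
  by rewrite !mnm_coordE eqxx.
have [->//|ja] := eqVneq j a.
have := sq_G j jP ja; rewrite GE => /(WsetP _ aQ)[_ _ _ c2 _]; apply: contraT => /c2.
by rewrite !mnm_coordE !eqxx (eq_sym a j) (negPf ja) => /(_ erefl).
Qed.

(** * Explicit descriptions and the classification *)

Lemma Uset_deg2 (q : nat) (b : 'X_{1..q}) : mdeg b = 2 ->
  Uset 3 b = [fset (b + U_(i))%MM | i : 'I_q].
Proof.
move=> b2; apply/fsetP => c; apply/idP/imfsetP => /=.
  move=> /Uset_addP[c' [-> + _]]; rewrite b2 => -[/mdeg1_eq[i ->]].
  by exists i.
move=> [i _ ->]; apply/Uset_addP; exists U_(i)%MM.
by rewrite b2 mdeg1; split=> // j; rewrite mnm1E; case: eqP.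
Qed.

Lemma Uset_deg1 (q : nat) (b : 'X_{1..q}) : mdeg b = 1 ->
  Uset 3 b = [fset (b + U_(t.1) + U_(t.2))%MM | t : 'I_q * 'I_q & (t.1 < t.2)%N].
Proof.
move=> b1; apply/fsetP => c; apply/idP/imfsetP => /=.
  move=> /Uset_addP[c' [-> + c'1]]; rewrite b1 => -[/sqfree2/(_ c'1)[i [j [ij ->]]]].
  by exists (i, j); rewrite ?inE ?addmA.
move=> [[i j]]; rewrite [_ \in _]inE /= => ij ->; rewrite -addmA.
apply/Uset_addP; exists (U_(i) + U_(j))%MM.
rewrite b1 mdegD !mdeg1; split=> // l; rewrite !mnm_coordE.
by apply: two_units_le1; apply: contraTneq ij => ->; rewrite ltnn.
Qed.

Lemma Uset_deg0 (q : nat) :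
  Uset 3 (0%MM : 'X_{1..q})
  = [fset (U_(t.1.1) + U_(t.1.2) + U_(t.2))%MM
       | t : 'I_q * 'I_q * 'I_q & (t.1.1 < t.1.2 < t.2)%N].
Proof.
apply/fsetP => c; apply/idP/imfsetP => /=.
  move=> /Uset_addP[c' [-> + c'1]]; rewrite mdeg0 add0n add0m => /sqfree3/(_ c'1)[i [j [l [ijl ->]]]].
  by exists (i, j, l); rewrite ?inE.
move=> [[[i j] l]]; rewrite [_ \in _]inE /= => /andP[ij jl] ->.
apply/Uset_addP; exists (U_(i) + U_(j) + U_(l))%MM.
rewrite mdeg0 add0m mdeg_triple; split=> // x.
by apply: triple_le1; rewrite -val_eqE neq_ltn ?ij ?jl ?(ltn_trans ij jl).
Qed.

Lemma is_facetP (k : fieldType) (q : nat) (F : {fset 'X_{1..q}}) : (0 < q)%N ->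
  is_facet (Scarf k q 3) F <-> listed_facet F.
Proof.
move=> q_gt0; split=> [[/ScarfP[//|FN sepF] maxF]|LF].
  have [G LG FG] := separated_in_facet q_gt0 FN sepF.
  by rewrite -(maxF G) //; apply/ScarfP => //; apply: listed_separated.
split=> [|t /ScarfP[//|tN sep_t] Ft]; first by apply/ScarfP => //; apply: listed_separated.
have [G LG tG] := separated_in_facet q_gt0 tN sep_t.
have GF := listed_antichain LF LG (fsubset_trans Ft tG).
by apply/eqP; rewrite eqEfsubset Ft -[in X in _ `<=` X]GF tG.
Qed.

Theorem theorem5p3 (k : fieldType) (q : nat) (hq : (1 <= q)%N) :
  (forall F : {fset 'X_{1..q}},
    is_facet (Scarf k q 3) F <->
       ((1 <= q)%N /\ exists a : 'I_q, F = Uset 3 (U_(a) *+ 2)%MM)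
    \/ ((2 <= q)%N /\ exists a b : 'I_q,
          a <> b /\ F = Uset 3 (U_(a) + U_(b))%MM)
    \/ ((3 <= q)%N /\ exists a : 'I_q, F = Uset 3 U_(a)%MM)
    \/ ((4 <= q)%N /\ F = Uset 3 (0%MM : 'X_{1..q}))
    \/ ((5 <= q)%N /\ exists (P : {set 'I_q}) (a : 'I_q),
          (2 <= #|P|)%N /\ (#|P| <= q - 3)%N /\ a \in P /\ F = Wset P a))
  /\ (forall a : 'I_q,
        Uset 3 (U_(a) *+ 2)%MM = [fset (U_(a) *+ 2 + U_(i))%MM | i : 'I_q])
  /\ (forall a b : 'I_q, a <> b ->
        Uset 3 (U_(a) + U_(b))%MM
          = [fset (U_(a) + U_(b) + U_(i))%MM | i : 'I_q])
  /\ (forall a : 'I_q,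
        Uset 3 U_(a)%MM
          = [fset (U_(a) + U_(t.1) + U_(t.2))%MM | t : 'I_q * 'I_q & (t.1 < t.2)%N])
  /\ (Uset 3 (0%MM : 'X_{1..q})
        = [fset (U_(t.1.1) + U_(t.1.2) + U_(t.2))%MM
             | t : 'I_q * 'I_q * 'I_q & (t.1.1 < t.1.2 < t.2)%N])
  /\ ((2 <= q)%N -> forall s : {fset 'X_{1..q}},
        Scarf k q 3 s <->
          Ucomplex q 3 s \/
          generated (fun F => exists (P : {set 'I_q}) (a : 'I_q),
            (2 <= #|P|)%N /\ (#|P| <= q - 3)%N /\ a \in P /\ F = Wset P a) s).
Proof.
split; [move=> F|split; [move=> a|split; [move=> a b _|split; [move=> a|split; [|move=> q2 s]]]]].
- split=> [/(is_facetP k F hq)|types]; last apply/(is_facetP k F hq).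
    case=> [a|a b ab|a q3|q4|P a P2 Pq aP].
    + by left; split=> //; exists a.
    + right; left; split; last by exists a, b; split=> //; apply/eqP.
      by rewrite -[q]card_ord; apply/card_gt1P; exists a, b.
    + by right; right; left; split=> //; exists a.
    + by right; right; right; left.
    + by right; right; right; right; split; [lia | exists P, a].
  case: types => [[_ [a ->]]|[[_ [a [b [/eqP ab ->]]]]|[[q3 [a ->]]|[[q4 ->]|[_ [P [a [P2 [Pq [aP ->]]]]]]]]]].
  + exact: FacetCube.
  + exact: FacetPair.
  + exact: FacetStar.
  + exact: FacetSqfree.
  + exact: FacetW.
- by apply: Uset_deg2; rewrite mdegMn mdeg1.
- by apply: Uset_deg2; rewrite mdegD !mdeg1.
- by apply: Uset_deg1; rewrite mdeg1.
- exact: Uset_deg0.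
split=> [/ScarfP[//|sN sep_s]|].
  have [F LF sF] := separated_in_facet hq sN sep_s.
  case: LF sF => [a|a b ab|a q3|q4|P a P2 Pq aP] sF; last by right; exists (Wset P a) => //; exists P, a.
  1-4: left; eexists; last exact: sF.
  1-4: eexists; split; [|split; [|by []]].
  1-8: by rewrite ?mdegMn ?mdegD ?mdeg1 ?mdeg0; lia.
have face F : listed_facet F -> s `<=` F -> Scarf k q 3 s.
  move=> /listed_separated[FN sepF] sF; apply/ScarfP => //; split; first exact: fsubset_trans FN.
  move=> c /sepF[A sepA]; exists A => d ds; exact/sepA/(fsubsetP sF).
case=> [[F [b [b_gt [b_lt ->]]] sF]|[F [P [a [P2 [Pq [aP ->]]]]] sF]]; last first.
  by apply: face sF; apply: FacetW.
apply: face sF; have [b0|[b1|b2]] : mdeg b = 0 \/ mdeg b = 1 \/ mdeg b = 2 by lia.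
- have /eqP-> : b == 0%MM by rewrite -mdeg_eq0 b0.
  by apply: FacetSqfree; rewrite b0 in b_gt.
- by have [a ->] := mdeg1_eq b1; apply: FacetStar; lia.
have [i [j ->]] := mdeg2_eq b2.
have [->|ij] := eqVneq i j; last exact: FacetPair.
by have -> : (U_(j) + U_(j) = U_(j) *+ 2)%MM; [rewrite mulmS mulm1n | apply: FacetCube].
Qed.
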